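(* Consider the uncertain nonlinear system $x^{(n)}=f(\mathbf{x})+b(\mathbf{x})u$ with state $\mathbf{x}=[x,\dot{x},\ldots,x^{(n-1)}]$, where $f,b:\mathbb{R}^n\to\mathbb{R}$, and suppose that: (1) $f$ is unknown but $|\hat{f}(\mathbf{x})-f(\mathbf{x})|\le F(\mathbf{x})$ for all $\mathbf{x}$, where $\hat{f}$ is an estimate of $f$ and $F$ is a known function of $\mathbf{x}$; (2) $b(\mathbf{x})$ is unknown but $0<b_{\mathrm{min}}\le b(\mathbf{x})\le b_{\mathrm{max}}$ for all $\mathbf{x}$, with constants $b_{\mathrm{min}},b_{\mathrm{max}}$; (3) the state vector $\mathbf{x}$ is available (i.e. may be used in the control law); (4) the desired trajectory $\mathbf{x}_d=[x_d,\dot{x}_d,\ldots,x_d^{(n-1)}]$ is once differentiable in time, and every element of $\mathbf{x}_d$, as well as $x_d^{(n)}$, is available and has known bounds. Let $\eta>0$ and $\phi>0$ be constants, let $\hat{b}=\sqrt{b_{\mathrm{max}}b_{\mathrm{min}}}$ and $\beta=\sqrt{b_{\mathrm{max}}/b_{\mathrm{min}}}$, and let the control be $$u=\hat{b}^{-1}\left(-\hat{f}+x^{(n)}_d-\bar{\mathbf{c}}^{\mathrm{T}}\tilde{\mathbf{x}}\right)-K\varphi(s,\phi),$$ where the gain $K>0$ satisfies $$K\ge\beta\hat{b}^{-1}(\eta+F)+(\beta-1)\left|\hat{b}^{-1}\left(-\hat{f}+x^{(n)}_d-\bar{\mathbf{c}}^{\mathrm{T}}\tilde{\mathbf{x}}\right)\right|.$$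 Then this controller ensures the finite-time convergence of the tracking error vector to the boundary layer $S_\phi=\{\mathbf{x}\in\mathbb{R}^n : |s(\tilde{\mathbf{x}})|\le\phi\}$; that is, for every solution of the closed-loop system there is a finite time $T\ge 0$ such that $|s(\tilde{\mathbf{x}}(t))|\le\phi$ for all $t\ge T$.
   Context: Here $n\ge 1$, time is $t\in[0,\infty)$, $u$ is the scalar control input, $x$ is the scalar output, and $x^{(i)}$ denotes the $i$-th time derivative. Solutions of the closed-loop system are functions $x$ on $[0,\infty)$ satisfying $x^{(n)}=f(\mathbf{x})+b(\mathbf{x})u$ with the stated $u$. Tracking error: $\tilde{x}=x-x_d$; the tracking error vector is $\tilde{\mathbf{x}}=\mathbf{x}-\mathbf{x}_d=[\tilde{x},\dot{\tilde{x}},\ldots,\tilde{x}^{(n-1)}]$. Let $\lambda>0$ be a constant and $c_i=\binom{n-1}{i}$ for $i=0,1,\ldots,n-1$. The function $s$ is $$s(\tilde{\mathbf{x}})=\left(\frac{d}{dt}+\lambda\right)^{n-1}\tilde{x}=\mathbf{c}^{\mathrm{T}}\tilde{\mathbf{x}},\qquad \mathbf{c}=[c_{n-1}\lambda^{n-1},\ldots,c_1\lambda,c_0],$$ and $\bar{\mathbf{c}}=[0,c_{n-1}\lambda^{n-1},\ldots,c_1\lambda]$, so that $\dot{s}=\tilde{x}^{(n)}+\bar{\mathbf{c}}^{\mathrm{T}}\tilde{\mathbf{x}}$. The function $\varphi(s,\phi)$ is a continuous approximation of the sign function: it is a continuous interpolation for $|s|\le\phi$ and behaves exactly like the sign function outside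 the boundary layer, i.e. $\varphi(s,\phi)=\mathrm{sgn}(s)$ whenever $|s|\ge\phi$. A typical choice is $\varphi(s,\phi)=\mathrm{sat}(s/\phi)$, where $\mathrm{sat}(y)=\mathrm{sgn}(y)$ for $|y|\ge 1$ and $\mathrm{sat}(y)=y$ for $|y|<1$. Here $\mathrm{sgn}(y)=-1,0,1$ for $y<0$, $y=0$, $y>0$ respectively. The gain $K$ may depend on the state and on time. *)

(* Defs.v *)
From HB Require Import structures.
From mathcomp Require Import all_boot all_order all_algebra.
From mathcomp Require Import all_classical all_reals all_analysis.

Set Implicit Arguments.
Unset Strict Implicit.
Unset Printing Implicit Defensive.

Import Order.TTheory GRing.Theory Num.Theory.
Import numFieldNormedType.Exports.

Local Open Scope classical_set_scope.
Local Open Scope ring_scope.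

(* Differentiation of functions of time on [0, +oo[: two-sided for t > 0,
   one-sided (from the right) at t = 0, so that values at negative times never
   matter.  Both definitions are only meant to be used for t >= 0. *)
Definition derivable_ge0 (R : realType) (g : R -> R) (t : R) : Prop :=
  if 0 < t then derivable g t 1
  else cvg (h^-1 * (g (t + h) - g t) @[h --> 0^'+]).

Definition derive_ge0 (R : realType) (g : R -> R) (t : R) : R :=
  if 0 < t then derive1 g t
  else lim (h^-1 * (g (t + h) - g t) @[h --> 0^'+]).

Definition deriven_ge0 (R : realType) (i : nat) (g : R -> R) : R -> R :=
  iter i (@derive_ge0 R) g.

Definition derivablen_ge0 (R : realType) (n : nat) (g : R -> R) : Prop :=
  forall (i : nat) (t : R), (i < n)%N -> 0 <= t ->
    derivable_ge0 (deriven_ge0 i g) t.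

(* [g(t), g'(t), ..., g^(n-1)(t)] *)
Definition state (R : realType) (n : nat) (g : R -> R) (t : R) : 'rV[R]_n :=
  \row_(i < n) deriven_ge0 i g t.

Definition dot (R : realType) (n : nat) (u v : 'rV[R]_n) : R :=
  (u *m v^T) 0 0.

(* [c_{n-1} lam^{n-1}, ..., c_1 lam, c_0] with c_i = 'C(n-1, i) *)
Definition cvec (R : realType) (n : nat) (lam : R) : 'rV[R]_n :=
  \row_(i < n) ('C(n.-1, n.-1 - i)%:R * lam ^+ (n.-1 - i)).

(* [0, c_{n-1} lam^{n-1}, ..., c_1 lam] *)
Definition cbar (R : realType) (n : nat) (lam : R) : 'rV[R]_n :=
  \row_(i < n) if i == 0%N :> nat then 0
               else 'C(n.-1, n - i)%:R * lam ^+ (n - i).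

(* With 'X standing for d/dt, the combination s = c^T e is the operator
   (d/dt + lam)^(n-1), and ds/dt = e^(n) + cbar^T e. *)
Lemma cvec_poly (R : realType) (n : nat) (lam : R) : (0 < n)%N ->
  \sum_(i < n) cvec n lam 0 i *: 'X^i = ('X + lam%:P) ^+ n.-1.
Proof.
case: n => // n _; rewrite addrC exprDn; apply: eq_bigr => i _.
rewrite !mxE /= bin_sub -1?ltnS // -mul_polyC polyCM polyC_exp.
by rewrite -mulrA polyC_natr mulr_natl.
Qed.

Lemma cbar_poly (R : realType) (n : nat) (lam : R) : (0 < n)%N ->
  'X * ('X + lam%:P) ^+ n.-1 = 'X^n + \sum_(i < n) cbar n lam 0 i *: 'X^i.
Proof.
case: n => // n _; rewrite -cvec_poly // big_ord_recr big_ord_recl /= mulrDr.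
rewrite !mxE /= subnn bin0 expr0 mulr1 !scale1r scale0r add0r -exprS addrC.
congr (_ + _); rewrite mulr_sumr; apply: eq_bigr => i _.
by rewrite !mxE /= /bump /= add1n subSS -scalerAr -exprS.
Qed.

Definition s_fun (R : realType) (n : nat) (lam : R) (e : 'rV[R]_n) : R :=
  dot (cvec n lam) e.

(* The boundary layer, for the current value yd of the desired trajectory. *)
Definition boundary_layer (R : realType) (n : nat) (lam phi : R)
    (yd : 'rV[R]_n) : set 'rV[R]_n :=
  [set y | `|s_fun lam (y - yd)| <= phi].

Definition sgn_approx (R : realType) (varphi : R -> R -> R) : Prop :=
  forall phi : R, 0 < phi ->
    continuous (fun s => varphi s phi) /\
    (forall s : R, phi <= `|s| -> varphi s phi = Num.sg s).

Definition bhat (R : realType) (bmin bmax : R) : R := Num.sqrt (bmax * bmin).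

Definition beta (R : realType) (bmin bmax : R) : R := Num.sqrt (bmax / bmin).

(* bhat^-1 (- fhat + xd^(n) - cbar^T e), as a feedback of state y and time t *)
Definition u_eq (R : realType) (n : nat) (lam bmin bmax : R)
    (fhat : 'rV[R]_n -> R) (xd : R -> R) (y : 'rV[R]_n) (t : R) : R :=
  (bhat bmin bmax)^-1 *
  (- fhat y + deriven_ge0 n xd t - dot (cbar n lam) (y - state n xd t)).

Definition control (R : realType) (n : nat) (lam bmin bmax phi : R)
    (fhat : 'rV[R]_n -> R) (xd : R -> R) (K : 'rV[R]_n -> R -> R)
    (varphi : R -> R -> R) (y : 'rV[R]_n) (t : R) : R :=
  u_eq lam bmin bmax fhat xd y t
  - K y t * varphi (s_fun lam (y - state n xd t)) phi.

Definition is_solution (R : realType) (n : nat) (f b : 'rV[R]_n -> R)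
    (u : 'rV[R]_n -> R -> R) (x : R -> R) : Prop :=
  derivablen_ge0 n x /\
  forall t : R, 0 <= t ->
    deriven_ge0 n x t
    = f (state n x t) + b (state n x t) * u (state n x t) t.

(* Main.v *)
Require Import Defs.
From HB Require Import structures.
From mathcomp Require Import all_boot all_order all_algebra.
From mathcomp Require Import all_classical all_reals all_analysis.
From mathcomp Require Import ring lra.

Set Implicit Arguments.
Unset Strict Implicit.
Unset Printing Implicit Defensive.

Import Order.TTheory GRing.Theory Num.Theory.
Import numFieldNormedType.Exports.

Local Open Scope classical_set_scope.
Local Open Scope ring_scope.

(** The scalar s obeys a first-order law: since s is the combination c^T e of
    the tracking error e and its derivatives, ds/dt = e^(n) + cbar^T e
    ([is_derive_s_fun]).  Substituting the dynamics and the control, and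
    writing v for the nominal control [u_eq], the terms in xd and cbar cancel
    against bhat v and leave
      ds/dt = (f - fhat) + (b - bhat) v - b K varphi(s, phi).
    The first two terms, which come from the model uncertainty, are bounded by
    b K - eta: this is what the lower bound on K is designed for
    ([gain_dominates]).  Outside the boundary layer varphi is the sign of s, so
    ds/dt <= - eta where s >= phi, and ds/dt >= eta where s <= - phi.

    A function that decreases at rate at least eta while it is at least phi
    can only be above phi at a time c if it has been decreasing at that rate
    ever since any earlier time a ([decay_above_level]).  This one fact, used
    for s and for - s, gives both that the layer is reached and that it is
    never left: from a = 1, being outside at time t would force
    eta (t - 1) < |s(1)|, hence T = 1 + |s(1)| / eta works. *)

Lemma bhat_beta (R : realType) (bmin bmax : R) :
  0 < bmin -> 0 <= bmax -> bhat bmin bmax = beta bmin bmax * bmin.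
Proof.
move=> m0 M0; rewrite /bhat /beta.
have -> : bmax * bmin = bmax / bmin * bmin ^+ 2 by field; rewrite gt_eqF.
by rewrite sqrtrM ?divr_ge0 // ?(ltW m0) // sqrtr_sqr gtr0_norm.
Qed.

Lemma beta_ge1 (R : realType) (bmin bmax : R) :
  0 < bmin -> bmin <= bmax -> 1 <= beta bmin bmax.
Proof.
by move=> m0 mM; rewrite /beta -sqrtr1 ler_wsqrtr // ler_pdivlMr // mul1r.
Qed.

(** The geometric mean bhat is the best estimate of b in ratio: it is within a
    factor beta of both bmin and bmax, hence of b.  So
    |1 - bhat / b| <= max(beta - 1, 1 - 1 / beta), and the maximum is
    beta - 1. *)
Lemma dist_bhat_le (R : realType) (bmin bmax b : R) :
  0 < bmin -> bmin <= b <= bmax ->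
  `|b - bhat bmin bmax| <= b * (beta bmin bmax - 1).
Proof.
move=> m0 /andP[mb bM]; have mM := le_trans mb bM.
have M0 : 0 <= bmax by rewrite (le_trans _ mM) // ltW.
have r1 := beta_ge1 m0 mM; have eqM : bmax = beta bmin bmax ^+ 2 * bmin.
  by rewrite sqr_sqrtr ?divr_ge0 // ?(ltW m0) // divfK // gt_eqF.
rewrite bhat_beta //; move: (beta _ _) r1 eqM => r r1 eqM.
have r0 : 0 < r by lra.
rewrite ler_norml; apply/andP; split.
  suff : 0 <= r * (b - bmin) by lra.
  by rewrite mulr_ge0; lra.
(* This side is 1 - 1 / beta <= beta - 1, that is (beta - 1)^2 >= 0, once
   b <= bmax = beta^2 bmin is used. *)
rewrite -subr_ge0 -(pmulr_rge0 _ r0).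
have -> : r * (b * (r - 1) - (b - r * bmin)) = b * (r - 1) ^+ 2 + (bmax - b).
  by rewrite eqM; ring.
by rewrite addr_ge0 ?subr_ge0 // mulr_ge0 ?sqr_ge0 //; lra.
Qed.

(** Each term of the gain answers one uncertainty.  As beta / bhat = 1 / bmin,
    multiplication by b turns the first into at least eta + F, which pays for
    the error d on f and leaves the margin eta; b (beta - 1) |v| pays for the
    error b - bhat on the input gain. *)
Lemma gain_dominates (R : realType) (bmin bmax b eta F d v k : R) :
  0 < bmin -> bmin <= b <= bmax -> 0 <= eta -> `|d| <= F ->
  beta bmin bmax * (bhat bmin bmax)^-1 * (eta + F)
    + (beta bmin bmax - 1) * `|v| <= k ->
  `|d + (b - bhat bmin bmax) * v| <= b * k - eta.
Proof.
move=> m0 hb eta0 dF hk; have dist := dist_bhat_le m0 hb.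
have /andP[mb bM] := hb; have mM := le_trans mb bM.
have b0 : 0 < b by rewrite (lt_le_trans m0).
have r1 := beta_ge1 m0 mM; have F0 : 0 <= F := le_trans (normr_ge0 d) dF.
have hbk := ler_wpM2l (ltW b0) hk.
have ratio : eta + F <= b * (beta bmin bmax / bhat bmin bmax * (eta + F)).
  rewrite bhat_beta ?(le_trans (ltW m0)) // mulrA ler_peMl ?addr_ge0 //.
  have -> : b * (beta bmin bmax / (beta bmin bmax * bmin)) = b / bmin.
    by field; rewrite !gt_eqF //; lra.
  by rewrite ler_pdivlMr // mul1r.
have dv := ler_wpM2r (normr_ge0 v) dist.
apply: le_trans (ler_normD _ _) _; rewrite normrM.
rewrite mulrDr mulrA -mulrA in hbk; lra.
Qed.

(** If g stays above phi on [a, c] this is the mean value theorem.  Otherwise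
    g is below phi at its minimiser m, yet above phi at the maximiser M of g
    over [m, c]; just before M the function g is still above phi, hence
    decreasing, so that it takes a value larger than g(M) there. *)
Lemma decay_above_level (R : realType) (g dg : R -> R) (phi eta a c : R) :
  0 < eta -> a <= c ->
  (forall t, t \in `[a, c] -> is_derive t 1 g (dg t)) ->
  (forall t, t \in `[a, c] -> phi <= g t -> dg t <= - eta) ->
  phi < g c -> g c <= g a - eta * (c - a).
Proof.
move=> eta0 ac gD dgN phic.
have sub p q : a <= p -> q <= c -> {subset `[p, q] <= `[a, c]}.
  by move=> ap qc t; rewrite !in_itv /= => /andP[pt tq]; apply/andP; split; lra.
have gC p q : a <= p -> q <= c -> {within `[p, q], continuous g}.
  move=> ap qc; apply: derivable_within_continuous => t tpq.
  by have [] := gD t (sub p q ap qc t tpq).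
have drop p q : a <= p -> p <= q -> q <= c ->
    (forall t, t \in `[p, q] -> phi <= g t) -> g q <= g p - eta * (q - p).
  move=> ap pq qc above.
  have gDo t : t \in `]p, q[ -> is_derive t 1 g (dg t).
    by move=> /subset_itv_oo_cc /(sub p q ap qc); exact: gD.
  have [t tpq E] := MVT_segment pq gDo (gC p q ap qc).
  have := dgN t (sub p q ap qc t tpq) (above t tpq).
  have qp0 : 0 <= q - p by rewrite subr_ge0.
  by move=> /(ler_wpM2r qp0); lra.
have [m mac gm] := EVT_min ac (gC a c (lexx _) (lexx _)).
have [phim|mphi] := leP phi (g m).
  by apply: drop => // t /gm; apply: le_trans.
have /andP[am mc] : a <= m <= c by rewrite in_itv in mac.
have [M Mmc gM] := EVT_max mc (gC m c am (lexx _)).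
have /andP[mM Mc] : m <= M <= c by rewrite in_itv in Mmc.
have phiM : phi < g M.
  by apply: (lt_le_trans phic); apply: gM; rewrite in_itv /= mc lexx.
have {}mM : m < M.
  by rewrite lt_neqAle mM andbT; apply/eqP => E; move: phiM mphi; rewrite E; lra.
have cM : {for M, continuous g}.
  apply: differentiable_continuous; apply/derivable1_diffP.
  by have [] := gD M (sub m c am (lexx _) M Mmc).
have /nbhs_ballP[e /= e0 eM] : \forall t \near M, phi < g t.
  exact: (cM _ (lt_nbhsr phiM)).
pose p := Num.max m (M - e / 2).
have pM : p < M by rewrite /p gt_max mM /=; lra.
have mp : m <= p by rewrite /p le_max lexx.
have pe : M - e / 2 <= p by rewrite /p le_max lexx orbT.
have above t : t \in `[p, M] -> phi <= g t.
  rewrite in_itv /= => /andP[pt tM].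
  by apply/ltW/eM; rewrite /ball /= ger0_norm; lra.
have gpM := drop p M (le_trans am mp) (ltW pM) Mc above.
have gp : g p <= g M by apply: gM; rewrite in_itv /=; apply/andP; split; lra.
have : 0 < eta * (M - p) by rewrite mulr_gt0 ?subr_gt0.
by lra.
Qed.

(** At positive times the derivatives on [0, +oo[ are the ordinary two-sided
    ones, which is all that the behaviour at large times depends on. *)
Lemma is_derive_deriven_ge0 (R : realType) (n i : nat) (g : R -> R) (t : R) :
  derivablen_ge0 n g -> (i < n)%N -> 0 < t ->
  is_derive t 1 (deriven_ge0 i g) (deriven_ge0 i.+1 g t).
Proof.
move=> gn lin t0; have := gn i t lin (ltW t0).
rewrite /derivable_ge0 t0 => /derivableP.
by rewrite -derive1E /deriven_ge0 iterS /derive_ge0 t0.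
Qed.

Lemma dotE (R : realType) (n : nat) (u v : 'rV[R]_n) :
  dot u v = \sum_(i < n) u 0 i * v 0 i.
Proof. by rewrite /dot mxE; apply: eq_bigr => i _; rewrite mxE. Qed.

(** The vector cbar is c shifted by one place, with the leading coefficient
    c_0 = 1 split off: this is the effect of one more differentiation. *)
Lemma sum_cvec_shift (R : realType) (n : nat) (lam : R) (a : nat -> R) :
  (0 < n)%N ->
  \sum_(i < n) cvec n lam 0 i * a i.+1 =
  a n + \sum_(i < n) cbar n lam 0 i * a i.
Proof.
case: n => // n _; rewrite big_ord_recr big_ord_recl /= !mxE /= subnn bin0.
rewrite expr0 !mul1r mul0r add0r addrC; congr (_ + _); apply: eq_bigr => i _.
by rewrite !mxE /= /bump /= add1n subSS.
Qed.

Lemma is_derive_s_fun (R : realType) (n : nat) (lam : R) (x xd : R -> R)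
    (t : R) : (0 < n)%N -> derivablen_ge0 n x -> derivablen_ge0 n xd -> 0 < t ->
  is_derive t 1 (fun t => s_fun lam (state n x t - state n xd t))
    (deriven_ge0 n x t - deriven_ge0 n xd t
     + dot (cbar n lam) (state n x t - state n xd t)).
Proof.
move=> n0 hx hxd t0.
pose e i := deriven_ge0 i x - deriven_ge0 i xd.
have stateE (u : 'rV[R]_n) r : dot u (state n x r - state n xd r) =
    \sum_(i < n) u 0 i * e i r.
  by rewrite dotE; apply: eq_bigr => i _; rewrite !mxE.
rewrite stateE -(@sum_cvec_shift R n lam (fun i => e i t)) //.
have -> : (fun r => s_fun lam (state n x r - state n xd r)) =
    \sum_(i < n) (cvec n lam 0 i \*: e i).
  by apply/funext => r; rewrite /s_fun stateE fct_sumE.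
have eD i : (i < n)%N -> is_derive t 1 (e i) (e i.+1 t).
  by move=> lin; apply: is_deriveB; apply: (is_derive_deriven_ge0 _ lin).
by apply: is_derive_sum => i; exact/is_deriveZ/eD.
Qed.

Theorem theorem1 (R : realType) (n : nat) (hn : (0 < n)%N)
  (f b fhat F : 'rV[R]_n -> R) (bmin bmax : R)
  (hf : forall y : 'rV[R]_n, `|fhat y - f y| <= F y)
  (hbmin : 0 < bmin)
  (hb : forall y : 'rV[R]_n, bmin <= b y <= bmax)
  (xd : R -> R) (Md : nat -> R)
  (hxd : derivablen_ge0 n xd)
  (hMd : forall (i : nat) (t : R), (i <= n)%N -> 0 <= t ->
     `|deriven_ge0 i xd t| <= Md i)
  (lam eta phi : R) (hlam : 0 < lam) (heta : 0 < eta) (hphi : 0 < phi)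
  (varphi : R -> R -> R) (hvarphi : sgn_approx varphi)
  (K : 'rV[R]_n -> R -> R)
  (hKpos : forall (y : 'rV[R]_n) (t : R), 0 <= t -> 0 < K y t)
  (hK : forall (y : 'rV[R]_n) (t : R), 0 <= t ->
     beta bmin bmax * (bhat bmin bmax)^-1 * (eta + F y)
     + (beta bmin bmax - 1) * `|u_eq lam bmin bmax fhat xd y t| <= K y t)
  (x : R -> R)
  (hx : is_solution f b (control lam bmin bmax phi fhat xd K varphi) x) :
  exists T : R, 0 <= T /\
    forall t : R, T <= t ->
      boundary_layer lam phi (state n xd t) (state n x t).
Proof.
have [hxn ode] := hx.
pose y t := state n x t; pose e t := y t - state n xd t.
pose s t := s_fun lam (e t).
pose ds t := deriven_ge0 n x t - deriven_ge0 n xd t + dot (cbar n lam) (e t).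
have sD (t : R) : 0 < t -> is_derive t 1 s (ds t).
  by move=> t0; exact: is_derive_s_fun.
have h0 : bhat bmin bmax != 0.
  have /andP[mb bM] := hb 0; have mM := le_trans mb bM.
  by rewrite gt_eqF // sqrtr_gt0 mulr_gt0 // (lt_le_trans hbmin).
pose v t := u_eq lam bmin bmax fhat xd (y t) t.
pose drift t := - (fhat (y t) - f (y t)) + (b (y t) - bhat bmin bmax) * v t.
have dsE (t : R) : 0 <= t ->
    ds t = drift t - b (y t) * K (y t) t * varphi (s t) phi.
  move=> t0; rewrite /ds ode // /drift /control -/(y t) -/(e t) -/(s t) -/(v t).
  have hv : bhat bmin bmax * v t =
      - fhat (y t) + deriven_ge0 n xd t - dot (cbar n lam) (e t).
    by rewrite /v /u_eq mulVKf.
  by rewrite mulrBl hv; ring.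
have driftP (t : R) : 0 <= t -> `|drift t| <= b (y t) * K (y t) t - eta.
  move=> t0; apply: (gain_dominates hbmin (hb (y t)) (ltW heta) _ (hK (y t) t t0)).
  by rewrite normrN.
have out_sgn (r : R) : phi <= `|r| -> varphi r phi = Num.sg r.
  exact: (hvarphi phi hphi).2.
have ds_pos_side (t : R) : 0 <= t -> phi <= s t -> ds t <= - eta.
  move=> t0 st; have s0 : 0 < s t by lra.
  rewrite dsE // out_sgn ?gtr0_norm // gtr0_sg // mulr1.
  by have := driftP t t0; rewrite ler_norml => /andP[]; lra.
have ds_neg_side (t : R) : 0 <= t -> phi <= - s t -> - ds t <= - eta.
  move=> t0 st; have s0 : s t < 0 by lra.
  rewrite dsE // out_sgn ?ltr0_norm // ltr0_sg // mulrN1.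
  by have := driftP t t0; rewrite ler_norml => /andP[]; lra.
(* The clock starts at 1 because s is differentiable (and continuous) in the
   ordinary sense only at positive times; any positive start would do. *)
exists (1 + `|s 1| / eta); split.
  by rewrite addr_ge0 // divr_ge0 // ltW.
move=> t Tt; rewrite /boundary_layer /= -/(y t) -/(e t) -/(s t).
have reach : `|s 1| <= eta * (t - 1).
  by rewrite mulrC -ler_pdivrMr // lerBrDl.
have t1 : 1 <= t by apply: le_trans Tt; rewrite lerDl divr_ge0 // ltW.
have pos (r : R) : r \in `[1, t] -> 0 < r.
  by rewrite in_itv /= => /andP[r1 _]; lra.
have /ler_normlP[sN sP] := reach.
rewrite ler_norml; apply/andP; split; rewrite leNgt; apply/negP => out.
- have outN : phi < - s t by rewrite ltrNr.
  have sND (r : R) : r \in `[1, t] ->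
      is_derive r 1 (fun q => - s q) (- ds r).
    by move=> r1; exact/is_deriveN/sD/pos.
  have := decay_above_level heta t1 sND _ outN.
  by move=> /(_ (fun r r1 => ds_neg_side r (ltW (pos r r1)))); lra.
- have sD1 (r : R) : r \in `[1, t] -> is_derive r 1 s (ds r).
    by move=> r1; exact/sD/pos.
  have := decay_above_level heta t1 sD1 _ out.
  by move=> /(_ (fun r r1 => ds_pos_side r (ltW (pos r r1)))); lra.
Qed.
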